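(* Let $(\mathcal{M},\rho)$ be a pseudometric space and let $X=\ell^2_\infty$, i.e. $\mathbf{R}^2$ with the norm $\|x\|=\max\{|x_1|,|x_2|\}$, with closed unit ball $B_X=[-1,1]^2$. Let $\mathcal{K}(X)$ be the family of all non-empty convex compact subsets of $X$, and let $F:\mathcal{M}\to\mathcal{K}(X)$ be a set-valued mapping such that for every subset $\mathcal{M}'\subset\mathcal{M}$ with $\#\mathcal{M}'\le4$ the restriction $F|_{\mathcal{M}'}$ has a Lipschitz selection with Lipschitz seminorm at most $1$. Let $$\lambda_1\ge1,\qquad\lambda_2\ge3\lambda_1,\qquad\gamma\ge\lambda_2\,\frac{3\lambda_2+\lambda_1}{\lambda_2-\lambda_1},$$ and for $x\in\mathcal{M}$ define $$F^{[1]}(x)=\bigcap_{z\in\mathcal{M}}\left[F(z)+\lambda_1\rho(x,z)B_X\right],\qquad F^{[2]}(x)=\bigcap_{z\in\mathcal{M}}\left[F^{[1]}(z)+\lambda_2\rho(x,z)B_X\right].$$ Then $F^{[2]}(x)\ne\emptyset$ for every $x\in\mathcal{M}$, and $$d_H(F^{[2]}(x),F^{[2]}(y))\le\gamma\,\rho(x,y)\quad\text{for every }x,y\in\mathcal{M}.$$ In particular, this holds for $\lambda_1=1$, $\lambda_2=3$ and $\gamma=15$.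
   Context: A pseudometric space $(\mathcal{M},\rho)$ is a set $\mathcal{M}$ with $\rho:\mathcal{M}\times\mathcal{M}\to[0,+\infty]$ satisfying $\rho(x,x)=0$, $\rho(x,y)=\rho(y,x)$ and $\rho(x,y)\le\rho(x,z)+\rho(z,y)$; $\rho(x,y)=0$ with $x\ne y$ and $\rho(x,y)=+\infty$ are allowed. When $r=+\infty$, $A+rB_X$ means $X$ for $A\neq\emptyset$ (and $\lambda\cdot(+\infty)=+\infty$ for $\lambda>0$). A selection of $F$ on $\mathcal{M}'$ is a map $f:\mathcal{M}'\to X$ with $f(x)\in F(x)$ for all $x\in\mathcal{M}'$. The Lipschitz seminorm is $\|f\|_{\mathrm{Lip}(\mathcal{M}',X)}=\inf\{\lambda>0:\|f(x)-f(y)\|\le\lambda\rho(x,y)\ \text{for all } x,y\in\mathcal{M}'\}$. The sum of sets is the Minkowski sum, $rB_X$ is the closed ball of radius $r$ centered at $0$, and the Hausdorff distance of non-empty bounded sets (with respect to the norm of $X$) is $d_H(A,B)=\inf\{r>0: A+rB_X\supset B \text{ and } B+rB_X\supset A\}$. *)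

(* Defs.v *)
From mathcomp Require Import all_boot all_order all_algebra.
From mathcomp Require Import all_classical all_reals all_analysis.

Set Implicit Arguments.
Unset Strict Implicit.
Unset Printing Implicit Defensive.

Import Order.TTheory GRing.Theory Num.Theory.
Import numFieldNormedType.Exports.

Local Open Scope classical_set_scope.
Local Open Scope ring_scope.

Definition pseudometric (R : realType) (M : Type) (rho : M -> M -> \bar R) :
    Prop :=
  [/\ forall x y, (0 <= rho x y)%E,
      forall x, rho x x = 0%E,
      forall x y, rho x y = rho y x &
      forall x y z, (rho x y <= rho x z + rho z y)%E].

(* The norm of the library on 'rV[R]_2 is the one of l^2_infty. *)
Lemma norm_rV2E (R : realType) (x : 'rV[R]_2) :
  `|x| = Num.max `|x ord0 ord0| `|x ord0 ord_max|.
Proof.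
apply/eqP; rewrite eq_le; apply/andP; split.
  rewrite {1}/Num.norm /= mx_normrE; apply/bigmax_leP; split=> [|[i j] _ /=].
    by rewrite le_max normr_ge0.
  rewrite [i]ord1 le_max; case: j => -[|[|//]] lt_j2.
    by rewrite (_ : Ordinal lt_j2 = ord0) ?lexx//; apply/val_inj.
  by rewrite (_ : Ordinal lt_j2 = ord_max) ?lexx ?orbT//; apply/val_inj.
rewrite ge_max {2 4}/Num.norm /= mx_normrE; apply/andP; split.
  exact: (le_bigmax _ (fun ij : 'I_1 * 'I_2 => `|x ij.1 ij.2|) (ord0, ord0)).
exact: (le_bigmax _ (fun ij : 'I_1 * 'I_2 => `|x ij.1 ij.2|) (ord0, ord_max)).
Qed.

(* r B_X for r in [0, +oo]. The library's closed_ball 0 r is not used since it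
   is the closure of an open ball, hence empty for r = 0. For r = +oo the set
   below is the whole space. *)
Definition cball0 (R : realType) (X : normedModType R) (r : \bar R) : set X :=
  [set v | (`|v|%:E <= r)%E].

(* A + r B_X; for r = +oo this is the whole space as soon as A is non-empty. *)
Definition thickening (R : realType) (X : normedModType R)
    (A : set X) (r : \bar R) : set X :=
  [set a + b | a in A & b in cball0 r].

Definition convex_compacts (R : realType) (X : normedModType R) :
    set (set X) :=
  [set A | [/\ A !=set0, convex_set A & compact A]].

(* A map defined on a subset M' of M is represented by a total map f : M -> X
   of which only the values on M' are relevant. *)
Definition selection (M X : Type) (F : M -> set X) (M' : set M) (f : M -> X) :
    Prop :=
  forall x, M' x -> F x (f x).

(* This is +oo when f is not Lipschitz on M'. *)
Definition lip_seminorm (R : realType) (M : Type) (rho : M -> M -> \bar R)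
    (X : normedModType R) (M' : set M) (f : M -> X) : \bar R :=
  ereal_inf [set l%:E | l in [set l : R | 0 < l /\
    forall x y, M' x -> M' y -> (`|f x - f y|%:E <= l%:E * rho x y)%E]].

(* x |-> \bigcap_z (F z + l * rho x z B_X): iterating with l1 and then l2
   yields F^[1] and F^[2]. *)
Definition refinement (R : realType) (M : Type) (rho : M -> M -> \bar R)
    (X : normedModType R) (l : R) (F : M -> set X) (x : M) : set X :=
  \bigcap_(z in [set: M]) thickening (F z) (l%:E * rho x z)%E.

Definition hausdorff_dist (R : realType) (X : normedModType R)
    (A B : set X) : \bar R :=
  ereal_inf [set r%:E | r in [set r : R |
    [/\ 0 < r, B `<=` thickening A r%:E & A `<=` thickening B r%:E]]].

(* Main.v *)
Require Import Defs.
From mathcomp Require Import all_boot all_order all_algebra.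
From mathcomp Require Import all_classical all_reals all_analysis.
From mathcomp Require Import ring lra.

Import Order.TTheory GRing.Theory Num.Theory.
Import numFieldNormedType.Exports.

Local Open Scope classical_set_scope.
Local Open Scope card_scope.
Local Open Scope ring_scope.

(** Write K_u(x) for F(u) + l1 rho(x,u) B, so that F1(x) is the intersection of
    the K_u(x), and suppose first that rho is finite. Everything is an
    intersection problem for convex sets in the plane, and the two tools are
    Helly's theorem and the injectivity of l^2_infty: a 1-Lipschitz map into it
    extends from any subset, one coordinate at a time (mcshane_extension). Hence
    the selections on four points may be assumed to be defined and 1-Lipschitz
    on all of M, and then g(x) lies in K_u(x) as soon as g(u) lies in F(u).
    Three sets K_u(x), K_v(x), K_w(x) thus always meet, and F1(x) is non-empty.

    The special feature of the norm is that a square is the intersection of two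
    strips, one for each coordinate. In helly_strips, compact convex sets are
    intersected with families of such strips; since strips of one direction are
    governed by intervals, only few triples have to be inspected. Applied to the
    K_u(z) and to a square, it shows (thickening_F1) that F1(z) + r B is the
    intersection of the K_u(z) + r B and of the two strips that it spans.
    As l1 <= l2, the sets K_u(z) + l2 rho(x,z) B contain K_u(x), so F2(x) is the
    intersection of the K_u(x) and of the strips spanned by the
    F1(z) + l2 rho(x,z) B. Helly's theorem for these sets (F2_meet) needs as its
    main input that K_u(x) meets two strips of different directions, coming from
    z and z'. That involves five points of M: u, two for z and two for z'. If z'
    is the one closer to x, four points are enough to find, again by Helly's
    theorem, a point of F1(z') that is within rho(x,z') of K_u(x) and whose
    coordinate is within rho(x,z) + rho(x,z') of that of F1(z). Moving it into
    K_u(x) costs another rho(x,z'), in total at most 3 rho(x,z) <= l2 rho(x,z)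
    (K_meet_strips_le); this is where the factor 3 comes from.

    For the Lipschitz estimate take p in F2(x) and add the square of radius
    g rho(x,y) around p to the family that defines F2(y). Now K_u(y), the square
    and F1(z) + l2 rho(y,z) B have to share a point, and it is found on a segment
    in K_u(y) (K_meet_near): its end p0 is close to p, and its end q0 is close to
    a point of F1(z) near p. Balancing the two gives the constant
    l2 (l2 + 3 l1) / (l2 - l1), which is at most the given bound.

    An infinite rho is handled by restricting to the component of points at
    finite distance from x; the other points impose no condition. *)

(** * Convex sets and Radon's theorem *)

Lemma convex_setP {R : realType} {X : lmodType R} (A : set X) :
  convex_set A <->
  (forall a b t, A a -> A b -> 0 <= t <= 1 -> A (t *: a + (1 - t) *: b)).
Proof.
split=> [cA a b t Aa Ab /andP[t0 t1]|cA a b t].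
  have := cA a b (Itv01 t0 t1); rewrite !inE; exact.
rewrite !inE => Aa Ab; apply: (cA a b t%:num) => //.
by apply/andP; split; [exact: ge0|exact: le1].
Qed.

Lemma convex_setI {R : realType} {X : lmodType R} (A B : set X) :
  convex_set A -> convex_set B -> convex_set (A `&` B).
Proof.
move=> /convex_setP cA /convex_setP cB; apply/convex_setP.
by move=> a b t [Aa Ba] [Ab Bb] t01; split; [exact: cA|exact: cB].
Qed.

(** The partial sums are handled without normalising: each is either zero or
    its total weight times a point of A. *)
Lemma convex_sum {R : realType} {X : lmodType R} (A : set X) {I : finType}
    (w : I -> R) (p : I -> X) :
  convex_set A -> (forall i, 0 <= w i) -> \sum_i w i = 1 ->
  (forall i, 0 < w i -> A (p i)) -> A (\sum_i w i *: p i).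
Proof.
move=> /convex_setP cA w0 w1 Ap.
suff H (s : seq I) :
    (\sum_(i <- s) w i = 0 /\ \sum_(i <- s) w i *: p i = 0) \/
    (0 < \sum_(i <- s) w i /\
     exists2 q, A q & \sum_(i <- s) w i *: p i = (\sum_(i <- s) w i) *: q).
  case: (H (index_enum I)) => [[]|[_ [q Aq ->]]].
    by rewrite w1 => /eqP; rewrite oner_eq0.
  by rewrite w1 scale1r.
elim: s => [|i s IH]; first by left; rewrite !big_nil.
rewrite !big_cons; have := w0 i; rewrite le_eqVlt => /predU1P[<-|wi].
  by rewrite scale0r !add0r.
right; case: IH => [[-> ->]|[ws [q Aq ->]]].
  by rewrite !addr0; split => //; exists (p i) => //; exact: Ap.
set W := \sum_(j <- s) w j in ws *.
have W0 : 0 < w i + W by exact: addr_gt0.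
split => //; exists ((w i / (w i + W)) *: p i + (1 - w i / (w i + W)) *: q).
  apply: cA => //; first exact: Ap.
  by rewrite divr_ge0 ?(ltW W0) ?(ltW wi)//= ler_pdivrMr// mul1r lerDl ltW.
rewrite scalerDr !scalerA; congr (_ *: _ + _ *: _); field; exact: lt0r_neq0.
Qed.

(** The n + 2 rows (p_i, 1) live in a space of dimension n + 1. *)
Lemma affine_dependence {R : realType} {n : nat} (p : 'I_n.+2 -> 'rV[R]_n) :
  exists a : 'I_n.+2 -> R,
    [/\ exists i, a i != 0, \sum_i a i = 0 & \sum_i a i *: p i = 0].
Proof.
pose A : 'M[R]_(n.+2, n + 1) := row_mx (\matrix_i p i) (const_mx 1).
have : kermx A != 0.
  rewrite kermx_eq0 /row_free neq_ltn; apply/orP; left.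
  by rewrite (leq_ltn_trans (rank_leq_col _))// addn1.
move=> /eqP/matrixP/existsNP[k /existsNP[i /eqP]].
rewrite [X in _ != X]mxE => ki.
pose a := row k (kermx A).
have : a *m A = 0 by rewrite -row_mul mulmx_ker row0.
rewrite mul_mx_row -[RHS](row_mx0 _ 1 n 1) => /eq_row_mx[ap a1].
exists (fun i => a ord0 i); split.
- by exists i; rewrite [a _ _]mxE.
- have : (a *m (const_mx 1 : 'cV_n.+2)) ord0 ord0 = 0 by rewrite a1 mxE.
  rewrite [LHS]mxE => a1E; rewrite -[RHS]a1E.
  by apply: eq_bigr => j _; rewrite [const_mx _ _ _]mxE mulr1.
- rewrite -[RHS]ap; apply/rowP => j; rewrite summxE [RHS]mxE.
  by apply: eq_bigr => l _; rewrite [LHS]mxE [X in _ = _ * X]mxE.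
Qed.

(** The critical case of Helly's theorem. The positive and the negative
    part of an affine dependence of the p_i write a single point q in two ways
    as a convex combination (Radon). For each j, one of the two does not involve
    p_j, hence only involves points of C_j. *)
Lemma radon_helly {R : realType} {n : nat} (C : 'I_n.+2 -> set 'rV[R]_n)
    (p : 'I_n.+2 -> 'rV[R]_n) :
  (forall i, convex_set (C i)) -> (forall i j, i != j -> C j (p i)) ->
  exists q, forall i, C i q.
Proof.
move=> cC Cp; have [a [[k ak] a0 ap0]] := affine_dependence p.
pose S := \sum_i Num.max (a i) 0.
have aE i : Num.max (a i) 0 - Num.max (- a i) 0 = a i.
  by rewrite /Num.max; do 2!case: ifPn; rewrite -?leNgt => *; lra.
have SN : S = \sum_i Num.max (- a i) 0.
  apply/eqP; rewrite -subr_eq0 -sumrB (eq_bigr a) ?a0// => i _; exact: aE.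
have pos (b : R) : 0 <= Num.max b 0 by rewrite le_max lexx orbT.
have S0 : 0 < S.
  rewrite lt_neqAle sumr_ge0 ?andbT; last by move=> *; exact: pos.
  apply/eqP => S_0; move: ak; rewrite -aE.
  have /psumr_eq0P -> //: \sum_i Num.max (a i) 0 = 0 by [].
  by have /psumr_eq0P -> //: \sum_i Num.max (- a i) 0 = 0;
    rewrite ?subrr ?eqxx// -SN.
pose q := \sum_i (Num.max (a i) 0 / S) *: p i.
have qE : q = \sum_i (Num.max (- a i) 0 / S) *: p i.
  apply/eqP; rewrite -subr_eq0 -sumrB.
  rewrite (eq_bigr (fun i => S^-1 *: (a i *: p i))) => [|i _].
    by rewrite -scaler_sumr ap0 scaler0.
  by rewrite -scalerBl -mulrBl aE scalerA mulrC.
have one (w : 'I_n.+2 -> R) : \sum_i w i = S -> \sum_i (w i / S) = 1.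
  by move=> wS; rewrite -mulr_suml wS divff// lt0r_neq0.
have w0 (b : R) : 0 <= Num.max b 0 / S by rewrite divr_ge0// ltW.
have w_gt0 (b : R) : (0 < Num.max b 0 / S) = (0 < b).
  by rewrite pmulr_lgt0 ?invr_gt0// lt_max ltxx orbF.
exists q => j; case: (leP (a j) 0) => aj; [|rewrite qE];
  apply: convex_sum => //; rewrite ?one// => i; rewrite w_gt0 => ai;
  by apply: Cp; apply: contraTneq ai => ->; rewrite -leNgt// oppr_le0 ltW.
Qed.

(** * Helly's theorem in the plane *)

Lemma helly_four {R : realType} (A B C D : set 'rV[R]_2) :
  convex_set A -> convex_set B -> convex_set C -> convex_set D ->
  A `&` B `&` C !=set0 -> A `&` B `&` D !=set0 -> A `&` C `&` D !=set0 ->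
  B `&` C `&` D !=set0 -> A `&` B `&` C `&` D !=set0.
Proof.
move=> cA cB cC cD [d [[dA dB] dC]] [c [[cA' cB'] cD']] [b [[bA bC] bD]].
move=> [a [[aB aC] aD]].
pose K (i : 'I_4) := nth A [:: A; B; C; D] i.
pose p (i : 'I_4) := nth a [:: a; b; c; d] i.
have [||q Kq] := radon_helly K p.
- by case=> -[|[|[|[|//]]]].
- by case=> -[|[|[|[|//]]]] i [[|[|[|[|//]]]] j].
exists q; split; first split; first split.
- exact: (Kq (@Ordinal 4 0 isT)).
- exact: (Kq (@Ordinal 4 1 isT)).
- exact: (Kq (@Ordinal 4 2 isT)).
- exact: (Kq (@Ordinal 4 3 isT)).
Qed.

(** Induction on the number of sets: by the case of four sets, intersecting all
    the others with the first one preserves the hypothesis on triples. *)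
Lemma helly_finite {R : realType} (n : nat) (K : 'I_n -> set 'rV[R]_2) :
  (forall i, convex_set (K i)) ->
  (forall i j k, K i `&` K j `&` K k !=set0) -> exists p, forall i, K i p.
Proof.
elim: n K => [|n IH] K cK K3; first by exists 0; case.
have [||p Kp] := IH (fun i => K ord0 `&` K (lift ord0 i)).
- by move=> i; exact: convex_setI.
- move=> i j k.
  have [q [[[q0 qi] qj] qk]] := helly_four _ _ _ _ (cK ord0) (cK (lift ord0 i))
    (cK (lift ord0 j)) (cK (lift ord0 k)) (K3 _ _ _) (K3 _ _ _) (K3 _ _ _)
    (K3 _ _ _).
  by exists q.
case: n {IH} K cK K3 p Kp => [|n] K _ K3 p Kp.
  have [q [[K0q _] _]] := K3 ord0 ord0 ord0.
  by exists q => i; rewrite [i]ord1.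
exists p => i; case: (unliftP ord0 i) => [j|] ->; first by have [] := Kp j.
by have [] := Kp ord0.
Qed.

Lemma helly {R : realType} {T : Type} (K : T -> set 'rV[R]_2) (i0 : T) :
  (forall i, convex_set (K i)) -> (forall i, closed (K i)) -> compact (K i0) ->
  (forall i j k, K i `&` K j `&` K k !=set0) -> exists p, forall i, K i p.
Proof.
move=> cK clK; rewrite compact_In0 => cpt K3.
have [|D' _|p Kp] := cpt {classic T} setT (fun i => K i0 `&` K i).
- by exists K => // i _; exact: clK.
- pose s : seq {classic T} := (i0 : {classic T}) :: finmap.enum_fset D'.
  have [||p Kp] := helly_finite (size s) (fun i => K (tnth (in_tuple s) i)).
  + by move=> i; exact: cK.
  + by move=> i j k; exact: K3.
  have Ks i : i \in s -> K i p.
    by move=> si; have /tnthP[j ->] : i \in in_tuple s by []; exact: Kp.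
  exists p => i /= iD; split; apply: Ks; first exact: mem_head.
  by rewrite inE iD orbT.
by exists p => i; have [] := Kp i I.
Qed.

(** The form in which Helly's theorem is applied to one additional set C: the
    triples among the K_i are known to meet, and only pairs have to be tested
    against C. *)
Lemma helly_add {R : realType} {T : Type} (K : T -> set 'rV[R]_2) (i0 : T)
    (C : set 'rV[R]_2) :
  (forall i, convex_set (K i)) -> (forall i, compact (K i)) ->
  convex_set C -> closed C -> (exists p, forall i, K i p) ->
  (forall i j, K i `&` K j `&` C !=set0) -> exists2 p, C p & forall i, K i p.
Proof.
move=> cK cptK cC clC [p Kp] KKC.
have clK i : closed (K i) := compact_closed (@norm_hausdorff _ _) (cptK i).
have [||||q Kq] := helly (fun i => K i `&` C) i0.
- by move=> i; exact: convex_setI.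
- by move=> i; exact: closedI.
- exact: compact_closedI.
- move=> i j k.
  have KKK : K i `&` K j `&` K k !=set0 by exists p.
  have [q [[[qi qj] qk] qC]] := helly_four _ _ _ _ (cK i) (cK j) (cK k) cC
    KKK (KKC _ _) (KKC _ _) (KKC _ _).
  by exists q.
by exists q; [have [] := Kq i0 | move=> i; have [] := Kq i].
Qed.

(** * Thickenings and coordinate strips *)

Lemma thickeningP {R : realType} {X : normedModType R} (A : set X) (r : R)
    (p : X) :
  thickening A r%:E p <-> exists2 a, A a & `|p - a| <= r.
Proof.
split=> [[a Aa [b]]|[a Aa pa]].
  by rewrite /cball0/= lee_fin => br <-; exists a; rewrite // addrAC subrr add0r.
exists a => //; exists (p - a); last by rewrite addrC subrK.
by rewrite /cball0/= lee_fin.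
Qed.

Lemma thickening_self {R : realType} {X : normedModType R} (A : set X) (r : R)
    (p : X) : 0 <= r -> A p -> thickening A r%:E p.
Proof.
by move=> r0 Ap; apply/thickeningP; exists p; rewrite // subrr normr0.
Qed.

Lemma thickening_le {R : realType} {X : normedModType R} (A : set X) (r s : R)
    (p : X) : r <= s -> thickening A r%:E p -> thickening A s%:E p.
Proof.
move=> rs /thickeningP[a Aa pa]; apply/thickeningP; exists a => //.
exact: le_trans rs.
Qed.

Lemma normr_conv {R : realType} {X : normedModType R} (u v : X) (t r s : R) :
  0 <= t <= 1 -> `|u| <= r -> `|v| <= s ->
  `|t *: u + (1 - t) *: v| <= t * r + (1 - t) * s.
Proof.
move=> /andP[t0 t1] ur vs; rewrite (le_trans (ler_normD _ _))// !normrZ.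
by rewrite (ger0_norm t0) ger0_norm ?lerD ?ler_wpM2l ?subr_ge0.
Qed.

Lemma convex_thickening {R : realType} {X : normedModType R} (A : set X)
    (r : R) : convex_set A -> convex_set (thickening A r%:E).
Proof.
move=> /convex_setP cA; apply/convex_setP => p q t.
move=> /thickeningP[a Aa pa] /thickeningP[b Ab qb] t01.
apply/thickeningP; exists (t *: a + (1 - t) *: b); first exact: cA.
rewrite opprD addrACA -!scalerBr.
rewrite (_ : r = t * r + (1 - t) * r); last by ring.
exact: normr_conv.
Qed.

Lemma compact_thickening {R : realType} {n : nat} (A : set 'rV[R]_n) (r : R) :
  compact A -> compact (thickening A r%:E).
Proof.
move=> cptA.
have -> : thickening A r%:E =
    (fun x : 'rV[R]_n * 'rV[R]_n => x.1 + x.2) @` (A `*` cball0 r%:E).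
  apply/seteqP; split => [_ [a Aa [b rb] <-]|_ [[a b] [Aa rb] <-]].
    by exists (a, b).
  by exists a => //; exists b.
apply: continuous_compact.
  by apply: continuous_subspaceT => x; exact: add_continuous.
apply: compact_setX => //; apply: bounded_closed_compact.
  exists r; split; first exact: num_real.
  move=> s rs v /=; rewrite /cball0/= lee_fin => /le_trans; apply.
  exact: ltW.
have -> : cball0 r%:E = (fun v : 'rV[R]_n => `|v|) @^-1` [set x | x <= r].
  by apply/seteqP; split=> v; rewrite /cball0/= lee_fin.
apply: closed_comp; last exact: closed_le.
by move=> v _; exact: norm_continuous.
Qed.

Lemma norm_le_coord {R : realType} (v : 'rV[R]_2) (r : R) :
  `|v| <= r <-> forall i, `|v ord0 i| <= r.
Proof.
rewrite norm_rV2E ge_max; split=> [/andP[v0 v1] i|H]; last by rewrite !H.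
case: i => -[|[|//]] lt_i.
  by rewrite (_ : Ordinal lt_i = ord0)//; exact/val_inj.
by rewrite (_ : Ordinal lt_i = ord_max)//; exact/val_inj.
Qed.

(** Strips are sets of the plane rather than intervals, so that Helly's theorem
    applies to them directly. *)
Definition strip {R : realType} (i : 'I_2) (A : set 'rV[R]_2) :
  set 'rV[R]_2 := [set p | exists2 a, A a & p ord0 i = a ord0 i].

Lemma sub_strip {R : realType} (i : 'I_2) (A : set 'rV[R]_2) : A `<=` strip i A.
Proof. by move=> p Ap; exists p. Qed.

(** A point witnessing the right-hand side may be far away in the other
    coordinate; copying its other coordinate gives a point of the thickening. *)
Lemma strip_thickening {R : realType} (i : 'I_2) (A : set 'rV[R]_2) (r : R)
    (p : 'rV[R]_2) :
  strip i (thickening A r%:E) p <->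
  exists2 a, A a & `|p ord0 i - a ord0 i| <= r.
Proof.
split=> [[q /thickeningP[a Aa qa] ->]|[a Aa pa]].
  by exists a => //; have /norm_le_coord/(_ i) := qa; rewrite !mxE.
pose q : 'rV[R]_2 := \row_j (if j == i then p ord0 j else a ord0 j).
exists q; last by rewrite mxE eqxx.
apply/thickeningP; exists a => //; apply/norm_le_coord => j.
rewrite !mxE; case: eqP => [->//|_].
by rewrite subrr normr0; exact: le_trans pa.
Qed.

Lemma convex_strip {R : realType} (i : 'I_2) (A : set 'rV[R]_2) :
  convex_set A -> convex_set (strip i A).
Proof.
move=> /convex_setP cA; apply/convex_setP => p q t [a Aa pa] [b Ab qb] t01.
by exists (t *: a + (1 - t) *: b); [exact: cA | rewrite !mxE pa qb].
Qed.

Lemma closed_strip {R : realType} (i : 'I_2) (A : set 'rV[R]_2) :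
  compact A -> closed (strip i A).
Proof.
move=> cptA; pose f (v : 'rV[R]_2) := v ord0 i.
have cf : continuous f by move=> v; exact: coord_continuous.
have -> : strip i A = f @^-1` (f @` A).
  by apply/seteqP; split=> p [a Aa fa]; exists a.
apply: closed_comp => [v _|]; first exact: cf.
apply: compact_closed; first exact: Rhausdorff.
by apply: continuous_compact => //; exact: continuous_subspaceT.
Qed.

Lemma convex_coord {R : realType} (i : 'I_2) (C : set 'rV[R]_2)
    (a b c : 'rV[R]_2) : convex_set C -> C a -> C b ->
  a ord0 i <= c ord0 i <= b ord0 i -> strip i C c.
Proof.
move=> /convex_setP cC Ca Cb /andP[ac cb].
have [ab|ab] := eqVneq (a ord0 i) (b ord0 i).
  by exists a => //; apply/eqP; rewrite eq_le ac ab cb.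
have ab0 : 0 < b ord0 i - a ord0 i.
  by rewrite subr_gt0 lt_neqAle ab (le_trans ac).
pose t := (b ord0 i - c ord0 i) / (b ord0 i - a ord0 i).
exists (t *: a + (1 - t) *: b).
  apply: cC => //; rewrite divr_ge0 ?subr_ge0// ?(le_trans ac)//=.
  by rewrite ler_pdivrMr// mul1r lerD2l lerN2.
rewrite !mxE /t; field; exact: lt0r_neq0.
Qed.

Lemma strip_idem {R : realType} (i : 'I_2) (A : set 'rV[R]_2) :
  strip i (strip i A) `<=` strip i A.
Proof. by move=> p [q [a Aa qa] pq]; exists a => //; rewrite pq. Qed.

(** This is Helly's theorem on the line, applied to i-th coordinates: of three
    points, each common to two of the three sets, the one with the median
    coordinate yields a common point. *)
Lemma strips_meet {R : realType} (i : 'I_2) (A B C : set 'rV[R]_2) :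
  convex_set A -> convex_set B -> convex_set C ->
  strip i A `&` strip i B !=set0 -> strip i A `&` C !=set0 ->
  strip i B `&` C !=set0 -> strip i A `&` strip i B `&` C !=set0.
Proof.
move=> cA cB cC [c [cA' cB']] [a [Aa Ca]] [b [Bb Cb]].
wlog ab : A B a b cA cB cA' cB' Aa Ca Bb Cb / a ord0 i <= b ord0 i.
  move=> H; case: (leP (a ord0 i) (b ord0 i)) => [/H|/ltW /H]; first exact.
  by rewrite (setIC (strip i A)); exact.
have btw D (p q r : 'rV[R]_2) : convex_set D -> strip i D p -> strip i D r ->
    p ord0 i <= q ord0 i <= r ord0 i -> strip i D q.
  move=> /(convex_strip i) cD Dp Dr pqr.
  by apply: strip_idem; exact: convex_coord pqr.
have [ca|ac] := leP (c ord0 i) (a ord0 i).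
  by exists a; do 2!split => //; apply: (btw _ c _ b) => //; rewrite ca.
have [cb|bc] := leP (c ord0 i) (b ord0 i).
  have [|q Cq cq] := convex_coord i _ a b c cC Ca Cb; first by rewrite ltW.
  exists q; split => //; split; [move: cA'|move: cB'] => -[d Ed cd];
    by exists d => //; rewrite -cq.
by exists b; do 2!split => //; apply: (btw _ a _ c) => //; rewrite ab ltW.
Qed.

(** Among three strips two always have the same direction, and strips_meet then
    reduces the three to pairs; this is why no condition on three strips
    appears. The conclusion says that p lies in the bounding box of every
    V_j. *)
Lemma helly_strips {R : realType} {T J : Type} (K : T -> set 'rV[R]_2)
    (u0 : T) (V : J -> set 'rV[R]_2) :
  (forall u, convex_set (K u)) -> (forall u, compact (K u)) ->
  (forall j, convex_set (V j)) -> (forall i j, closed (strip i (V j))) ->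
  (exists p, forall u, K u p) ->
  (forall u u' i j, K u `&` K u' `&` strip i (V j) !=set0) ->
  (forall u i j i' j', K u `&` strip i (V j) `&` strip i' (V j') !=set0) ->
  exists p, (forall u, K u p) /\ forall i j, strip i (V j) p.
Proof.
move=> cK cptK cV clV [p0 Kp0] KKV KVV.
pose G (x : T + 'I_2 * J) :=
  match x with inl u => K u | inr ij => strip ij.1 (V ij.2) end.
have clK u : closed (K u) := compact_closed (@norm_hausdorff _ _) (cptK u).
have VV i j i' j' : strip i (V j) `&` strip i' (V j') !=set0.
  by have [q [[_ ? ?]]] := KVV u0 i j i' j'; exists q.
have VVV i j j' i' j'' :
    strip i (V j) `&` strip i (V j') `&` strip i' (V j'') !=set0.
  by apply: strips_meet => //; exact: convex_strip.
have [| | | |p Gp] := helly G (inl u0).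
- by case=> [u|[i j]]; [exact: cK | exact: convex_strip].
- by case=> [u|[i j]]; [exact: clK | exact: clV].
- exact: cptK.
- case=> [u|[i j]] [u'|[i' j']] [u''|[i'' j'']] /=.
  + by exists p0.
  + exact: KKV.
  + by rewrite setIAC; exact: KKV.
  + exact: KVV.
  + by rewrite -setIA setIC; exact: KKV.
  + by rewrite (setIC (strip i _)); exact: KVV.
  + by rewrite setIC setIA; exact: KVV.
  + have [<-|ii'] := eqVneq i i'; first exact: VVV.
    have [<-|ii''] := eqVneq i i''; first by rewrite setIAC; exact: VVV.
    have <- : i' = i''.
      by move: i i' i'' ii' ii'' {KKV KVV VV VVV} => [[|[|//]] ?] [[|[|//]] ?]
        [[|[|//]] ?]; rewrite // => _ _; exact/val_inj.
    by rewrite -setIA setIC; exact: VVV.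
by exists p; split=> [u|i j]; [exact: (Gp (inl u)) | exact: (Gp (inr (i, j)))].
Qed.

(** The intermediate point divides the segment from a to p in ratio r : s. *)
Lemma thickening_add {R : realType} {X : normedModType R} (A : set X)
    (r s : R) : 0 <= r -> 0 <= s ->
  thickening A (r + s)%:E `<=` thickening (thickening A r%:E) s%:E.
Proof.
move=> r0 s0 p /thickeningP[a Aa pa]; apply/thickeningP.
have [rs0|rs0] := eqVneq (r + s) 0.
  exists a; first exact: thickening_self.
  by rewrite rs0 in pa; exact: le_trans s0.
have rs_ge0 : 0 <= r + s by exact: addr_ge0.
have rs_gt0 : 0 < r + s by rewrite lt_neqAle eq_sym rs0.
exists (a + (r / (r + s)) *: (p - a)).
  apply/thickeningP; exists a => //; rewrite addrAC subrr add0r normrZ.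
  rewrite ger0_norm ?divr_ge0// mulrAC ler_pdivrMr// ler_wpM2l//.
have -> : p - (a + (r / (r + s)) *: (p - a)) = (s / (r + s)) *: (p - a).
  rewrite opprD addrA -[X in X - _]scale1r -scalerBl; congr (_ *: _).
  by field.
rewrite normrZ ger0_norm ?divr_ge0// mulrAC ler_pdivrMr// ler_wpM2l//.
Qed.

Lemma refinement_finP {R : realType} {M : Type} {X : normedModType R}
    (d : M -> M -> R) (l : R) (F : M -> set X) (x : M) (p : X) :
  refinement (fun y z => (d y z)%:E) l F x p <->
  (forall z, thickening (F z) (l * d x z)%:E p).
Proof. by split=> [H z|H z _]; exact: H. Qed.

(** * The refinements for finite distances *)

Section Finite.
Context {R : realType} {M : Type} (d : M -> M -> R) (F : M -> set 'rV[R]_2).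
Context (l1 l2 : R).
Hypothesis d_ge0 : forall x y, 0 <= d x y.
Hypothesis dxx : forall x, d x x = 0.
Hypothesis d_sym : forall x y, d x y = d y x.
Hypothesis d_triangle : forall x y z, d x y <= d x z + d z y.
Hypothesis F_cc : forall x, convex_compacts (F x).
Hypothesis four_selection : forall x1 x2 x3 x4, exists g : M -> 'rV[R]_2,
  [/\ forall x y, `|g x - g y| <= d x y,
      F x1 (g x1), F x2 (g x2), F x3 (g x3) & F x4 (g x4)].
Hypothesis l1_ge1 : 1 <= l1.
Hypothesis l2_ge : 3 * l1 <= l2.

Let K u x := thickening (F u) (l1 * d x u)%:E.
Let F1 := refinement (fun x y => (d x y)%:E) l1 F.
Let F2 := refinement (fun x y => (d x y)%:E) l2 F1.

Let l1_ge0 : 0 <= l1. Proof. exact: le_trans l1_ge1. Qed.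
Let l2_ge3 : 3 <= l2. Proof. by apply: le_trans l2_ge; rewrite ler_peMr. Qed.
Let l2_ge1 : 1 <= l2. Proof. by apply: le_trans l2_ge3; rewrite ler1n. Qed.
Let l1_le2 : l1 <= l2.
Proof. by apply: le_trans l2_ge; rewrite ler_peMl// ler1n. Qed.
Let l2_ge0 : 0 <= l2. Proof. exact: le_trans l2_ge3. Qed.

Let F1P x p : F1 x p <-> forall u, K u x p. Proof. exact: refinement_finP. Qed.

Lemma convex_K u x : convex_set (K u x).
Proof. by apply: convex_thickening; have [] := F_cc u. Qed.

Lemma compact_K u x : compact (K u x).
Proof. by apply: compact_thickening; have [] := F_cc u. Qed.

Lemma closed_K u x : closed (K u x).
Proof. exact: compact_closed (@norm_hausdorff _ _) (compact_K u x). Qed.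

Lemma selection_K (g : M -> 'rV[R]_2) u x :
  (forall x y, `|g x - g y| <= d x y) -> F u (g u) -> K u x (g x).
Proof.
move=> g1 Fu; apply/thickeningP; exists (g u) => //.
by rewrite (le_trans (g1 _ _))// ler_peMl.
Qed.

(** The triangle inequality for d, transferred to the sets K_u. *)
Lemma move_K u x y : K u x `<=` thickening (K u y) (l1 * d x y)%:E.
Proof.
move=> p Kp; apply: thickening_add; rewrite ?mulr_ge0//.
by apply: thickening_le Kp; rewrite -mulrDr ler_wpM2l// addrC.
Qed.

Lemma convex_F1 x : convex_set (F1 x).
Proof.
apply/convex_setP => p q t /F1P Kp /F1P Kq t01; apply/F1P => u.
by have /convex_setP := convex_K u x; exact.
Qed.

Lemma compact_F1 x : compact (F1 x).
Proof.
apply: (subclosed_compact _ (compact_K x x)); last by move=> p /F1P.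
by apply: closed_bigI => u _; exact: closed_K.
Qed.

Lemma F1_neq0 x : F1 x !=set0.
Proof.
have [||||p Kp] := helly (fun u => K u x) x; last by exists p; exact/F1P.
- by move=> u; exact: convex_K.
- by move=> u; exact: closed_K.
- exact: compact_K.
- move=> u v w; have [g [g1 gu gv gw _]] := four_selection u v w w.
  by exists (g x); do 2?split; exact: selection_K.
Qed.

(** To be close to F1(z) in one coordinate, it is enough to be close to every
    K_v(z) `&` K_v'(z): F1(z) meets the strip around A by Helly's theorem. *)
Lemma F1_meet_strip (A : set 'rV[R]_2) (z : M) (i : 'I_2) (r : R) :
  convex_set A -> compact A ->
  (forall v v', K v z `&` K v' z `&` strip i (thickening A r%:E) !=set0) ->
  A `&` strip i (thickening (F1 z) r%:E) !=set0.
Proof.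
move=> cA cptA KKA.
have [||||||p Sp Kp] := helly_add (fun v => K v z) z
    (strip i (thickening A r%:E)).
- by move=> v; exact: convex_K.
- by move=> v; exact: compact_K.
- by apply: convex_strip; exact: convex_thickening.
- by apply: closed_strip; exact: compact_thickening.
- by have [p /F1P] := F1_neq0 z; exists p.
- exact: KKA.
have [a Aa pa] := (strip_thickening _ _ _ _).1 Sp.
exists a; split => //; apply/strip_thickening; exists p; first exact/F1P.
by rewrite distrC.
Qed.

(** Placing the auxiliary point at z', the closer of the two centers, makes
    every triple in Helly's theorem depend on at most four points of M. *)
Lemma K_meet_strips_le (u x z z' : M) (i i' : 'I_2) : d x z' <= d x z ->
  K u x `&` strip i (thickening (F1 z) (l2 * d x z)%:E)
    `&` strip i' (thickening (F1 z') (l2 * d x z')%:E) !=set0.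
Proof.
move=> ts.
pose C := thickening (K u x) (d x z')%:E.
pose D := strip i (thickening (F1 z) (d x z + d x z')%:E).
have cC : convex_set C by apply: convex_thickening; exact: convex_K.
have cptC : compact C by apply: compact_thickening; exact: compact_K.
have clC : closed C := compact_closed (@norm_hausdorff _ _) cptC.
have cD : convex_set D.
  by apply: convex_strip; apply: convex_thickening; exact: convex_F1.
have clD : closed D.
  by apply: closed_strip; apply: compact_thickening; exact: compact_F1.
have CP (g : M -> 'rV[R]_2) :
    (forall x y, `|g x - g y| <= d x y) -> F u (g u) -> C (g z').
  move=> g1 Fu; apply/thickeningP; exists (g x); first exact: selection_K.
  by rewrite (le_trans (g1 _ _))// d_sym.
(* The selections are used on four points: v and v' for F1(z), and two points
   that put g(z') into A. *)
have AD (A : set 'rV[R]_2) : convex_set A -> compact A ->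
    (forall v v', exists g : M -> 'rV[R]_2,
      [/\ forall x y, `|g x - g y| <= d x y, F v (g v), F v' (g v') &
          A (g z')]) -> A `&` D !=set0.
  move=> cA cptA gA; apply: F1_meet_strip => // v v'.
  have [g [g1 gv gv' Ag]] := gA v v'.
  exists (g z); do 2?split; try exact: selection_K.
  apply: sub_strip; apply/thickeningP; exists (g z') => //.
  by rewrite (le_trans (g1 _ _))// (le_trans (d_triangle _ _ x))// (d_sym z).
(* The four triples of the sets K_w(z'), K_w'(z'), C and D. *)
have KKC w w' : K w z' `&` K w' z' `&` C !=set0.
  have [g [g1 gw gw' gu _]] := four_selection w w' u u.
  by exists (g z'); do 2?split; [exact: selection_K..|exact: CP].
have KKD w w' : K w z' `&` K w' z' `&` D !=set0.
  apply: AD; first exact: convex_setI (convex_K _ _) (convex_K _ _).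
    exact: compact_closedI (compact_K _ _) (closed_K _ _).
  move=> v v'; have [g [g1 gv gv' gw gw']] := four_selection v v' w w'.
  by exists g; split => //; split; exact: selection_K.
have KCD w : K w z' `&` C `&` D !=set0.
  apply: AD; first exact: convex_setI (convex_K _ _) cC.
    exact: compact_closedI (compact_K _ _) clC.
  move=> v v'; have [g [g1 gv gv' gw gu]] := four_selection v v' w u.
  by exists g; split => //; split; [exact: selection_K | exact: CP].
have [||||||c Dc KCc] := helly_add (fun w => K w z' `&` C) z' D => //.
- by move=> w; exact: convex_setI (convex_K _ _) cC.
- by move=> w; exact: compact_closedI (compact_K _ _) clC.
- have [||||||c Cc Kc] := helly_add (fun w => K w z') z' C => //.
  + by move=> w; exact: convex_K.
  + by move=> w; exact: compact_K.
  + by have [p /F1P] := F1_neq0 z'; exists p.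
  + by exists c.
- move=> w w'.
  have [q [[[Kw Kw'] Cq] Dq]] := helly_four _ _ _ _ (convex_K w z')
    (convex_K w' z') cC cD (KKC _ _) (KKD _ _) (KCD _) (KCD _).
  by exists q.
have [_ /thickeningP[q Kq cq]] := KCc z'.
have cqi j : `|q ord0 j - c ord0 j| <= d x z'.
  by have /norm_le_coord/(_ j) := cq; rewrite !mxE distrC.
have ? := d_ge0 x z'; have ? := d_ge0 x z.
exists q; split; first split => //; apply/strip_thickening.
- have [a F1a ca] := (strip_thickening _ _ _ _).1 Dc; exists a => //.
  have := ler_distD (c ord0 i) (q ord0 i) (a ord0 i).
  have := cqi i; have := ler_wpM2r (d_ge0 x z) l2_ge3; lra.
- exists c; first by apply/F1P => w; have [] := KCc w.
  by rewrite (le_trans (cqi _))// ler_peMl.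
Qed.

Lemma K_meet_strips (u x z z' : M) (i i' : 'I_2) :
  K u x `&` strip i (thickening (F1 z) (l2 * d x z)%:E)
    `&` strip i' (thickening (F1 z') (l2 * d x z')%:E) !=set0.
Proof.
have [|/ltW] := leP (d x z') (d x z); first exact: K_meet_strips_le.
by move=> /(K_meet_strips_le u x z' z i' i); rewrite setIAC.
Qed.

(** For the sup norm, the distance from p to an intersection of convex sets is
    determined by the distances to the single sets and, in each coordinate, to
    the intersection. *)
Lemma thickening_F1 (z : M) (r : R) (p : 'rV[R]_2) :
  (forall u, thickening (K u z) r%:E p) ->
  (forall i, strip i (thickening (F1 z) r%:E) p) -> thickening (F1 z) r%:E p.
Proof.
move=> Kp Sp; pose V (_ : unit) := thickening [set p] r%:E.
have Vp q : `|p - q| <= r -> V tt q.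
  by move=> pq; apply/thickeningP; exists p => //; rewrite distrC.
have [| | | | | | |q [Kq Vq]] := helly_strips (fun u => K u z) z V.
- by move=> u; exact: convex_K.
- by move=> u; exact: compact_K.
- case; apply/convex_thickening/convex_setP => _ _ t -> -> _.
  by rewrite -scalerDl subrKC scale1r.
- by move=> i []; apply/closed_strip/compact_thickening/compact_set1.
- by have [q /F1P] := F1_neq0 z; exists q.
- move=> u u' i [].
  have [a /F1P F1a pa] := (strip_thickening _ _ _ _).1 (Sp i).
  exists a; split; first by split.
  by apply/strip_thickening; exists p => //; rewrite distrC.
- move=> u i [] i' []; have /thickeningP[a Ka /Vp Va] := Kp u.
  by exists a; split; first split => //; exact: sub_strip.
apply/thickeningP; exists q; first exact/F1P.
apply/norm_le_coord => i; rewrite !mxE.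
by have [_ -> ] := (strip_thickening _ _ _ _).1 (Vq i tt); rewrite distrC.
Qed.

(** The set Q stands for the additional constraint in the Lipschitz estimate, a
    square around a given point, and is the whole plane in the proof that F2(y)
    is non-empty. *)
Lemma F2_meet (y : M) (Q : set 'rV[R]_2) :
  convex_set Q -> (forall i, closed (strip i Q)) ->
  (forall u u' i, K u y `&` K u' y `&` strip i Q !=set0) ->
  (forall u i i', K u y `&` strip i Q `&` strip i' Q !=set0) ->
  (forall u z i i', K u y `&` strip i Q
    `&` strip i' (thickening (F1 z) (l2 * d y z)%:E) !=set0) ->
  exists2 q, F2 y q & forall i, strip i Q q.
Proof.
move=> cQ clQ KKQ KQQ KQV.
pose V j := if j is Some z then thickening (F1 z) (l2 * d y z)%:E else Q.
have [| | | | | | |q [Kq Vq]] := helly_strips (fun u => K u y) y V.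
- by move=> u; exact: convex_K.
- by move=> u; exact: compact_K.
- by case=> // z; exact/convex_thickening/convex_F1.
- by move=> i [z|//]; exact/closed_strip/compact_thickening/compact_F1.
- by have [p /F1P] := F1_neq0 y; exists p.
- move=> u u' i [z|//]; apply: F1_meet_strip.
  + exact: convex_setI (convex_K _ _) (convex_K _ _).
  + exact: compact_closedI (compact_K _ _) (closed_K _ _).
  + move=> v v'; have [g [g1 gu gu' gv gv']] := four_selection u u' v v'.
    exists (g z); do 2?split; try exact: selection_K.
    apply: sub_strip; apply/thickeningP; exists (g y).
      by split; exact: selection_K.
    by rewrite (le_trans (g1 _ _))// d_sym ler_peMl.
- move=> u i [z|] i' [z'|] /=; [exact: K_meet_strips| |exact: KQV|exact: KQQ].
  by rewrite setIAC; exact: KQV.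
exists q => [|i]; last exact: (Vq i None).
apply/refinement_finP => z; apply: thickening_F1 => [u|i]; last first.
  exact: (Vq i (Some z)).
apply: thickening_le (move_K u y z _ (Kq u)).
by rewrite ler_wpM2r.
Qed.

Lemma F2_neq0 x : F2 x !=set0.
Proof.
have ST i : strip i [set: 'rV[R]_2] = setT.
  by apply/seteqP; split=> // p _; exact: sub_strip.
have [| | | | |q F2q _] := F2_meet x setT; last by exists q.
- exact/convex_setP.
- by move=> i; rewrite ST; exact: closedT.
- move=> u u' i; rewrite ST setIT; have [p /F1P] := F1_neq0 x.
  by exists p.
- move=> u i i'; rewrite !ST !setIT; have [p /F1P] := F1_neq0 x.
  by exists p.
- move=> u z i i'; rewrite ST setIT.
  by have [p [[Kp _] Vp]] := K_meet_strips u x z z i' i'; exists p.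
Qed.

Lemma l2_le_g (g : R) : l2 * ((3 * l2 + l1) / (l2 - l1)) <= g -> l2 <= g.
Proof.
apply: le_trans; rewrite ler_peMr//.
have := l1_ge1; have := l2_ge => ? ?.
by rewrite ler_pdivlMr ?mul1r; lra.
Qed.

(** The point q divides the segment from p0 to q0, both in K_u(y), in a ratio
    chosen so that its distance to p', a point of F1(z), is at most l2 d(y,z):
    this distance is at most l1 d(x,y) + l2 (d(x,y) + d(y,z)) at p0 and
    l1 d(y,z) at q0. *)
Lemma K_meet_near (g : R) (u x y z : M) (p : 'rV[R]_2) :
  l2 * ((3 * l2 + l1) / (l2 - l1)) <= g -> F2 x p ->
  exists q, [/\ K u y q, `|q - p| <= g * d x y &
                thickening (F1 z) (l2 * d y z)%:E q].
Proof.
move=> gE F2p; have l2g := l2_le_g g gE.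
have F1p : F1 x p.
  have := (refinement_finP _ _ _ _ _).1 F2p x.
  by move=> /thickeningP[a F1a]; rewrite dxx mulr0 normr_le0 subr_eq0 => /eqP->.
have /(move_K _ _ y) /thickeningP[p0 Kp0 pp0] := (F1P _ _).1 F1p u.
have /thickeningP[p' F1p' pp'] := (refinement_finP _ _ _ _ _).1 F2p z.
have /(move_K _ _ y) /thickeningP[q0 Kq0 pq0] := (F1P _ _).1 F1p' u.
move: pp0 pp' pq0; rewrite (d_sym z y); set T := d y z; set e := d x y.
have xz : d x z <= e + T by exact: d_triangle.
have := d_ge0 x y; have := d_ge0 y z; rewrite -/T -/e => T0 e0 pp0 pp' pq0.
have D0 : 0 < l2 - l1 by have := l1_ge1; have := l2_ge; lra.
have g_ge : l2 * ((3 * l2 + l1) / (l2 - l1)) * (l2 - l1) <= g * (l2 - l1).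
  by rewrite ler_wpM2r// ltW.
rewrite mulrA divfK ?lt0r_neq0// in g_ge.
have [e_0|e_neq0] := eqVneq e 0.
  exists p0; split => //.
    by move: pp0; rewrite e_0 !mulr0 distrC.
  move: pp0; rewrite e_0 mulr0 normr_le0 subr_eq0 => /eqP <-.
  apply/thickeningP; exists p' => //; rewrite (le_trans pp')// ler_wpM2l//.
  by rewrite e_0 add0r in xz.
have e_gt0 : 0 < e by rewrite lt_neqAle eq_sym e_neq0.
set W := (l2 - l1) * T + (l1 + l2) * e.
have W0 : 0 < W.
  apply: ltr_wpDl; first by rewrite mulr_ge0// ltW.
  by rewrite mulr_gt0// ltr_wpDl// (lt_le_trans _ l2_ge1).
(* This weight makes the bound on the distance from q to p' equal to l2 T. *)
pose th := (l1 + l2) * e / W.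
have th0 : 0 <= th.
  by apply: divr_ge0; [rewrite mulr_ge0// addr_ge0 | exact: ltW].
have th1 : th <= 1.
  by rewrite ler_pdivrMr// mul1r lerDr mulr_ge0// ltW.
have thW : th * W = (l1 + l2) * e by rewrite divfK// lt0r_neq0.
have thE (a b : R) :
    (th * a + (1 - th) * b) * W = (l1 + l2) * e * a + (l2 - l1) * T * b.
  transitivity (th * W * a + (W - th * W) * b); first by ring.
  by rewrite thW /W; ring.
have cvx (a b c : 'rV[R]_2) (r s : R) : `|a - c| <= r -> `|b - c| <= s ->
    `|(th *: a + (1 - th) *: b) - c| <= th * r + (1 - th) * s.
  move=> ar bs.
  have -> : th *: a + (1 - th) *: b - c = th *: (a - c) + (1 - th) *: (b - c).
    rewrite !scalerBr addrACA -opprD -(scalerDl c th (1 - th)).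
    by rewrite subrKC scale1r.
  by apply: normr_conv => //; exact/andP.
have l2e := ler_wpM2l l2_ge0 xz.
exists (th *: q0 + (1 - th) *: p0); split.
- have /convex_setP := convex_K u y; apply => //; exact/andP.
- apply: le_trans (cvx _ _ _ (l1 * T + l2 * (e + T)) (l1 * e) _ _) _.
  + rewrite (le_trans (ler_distD p' _ _))// lerD// distrC//.
    exact: le_trans l2e.
  + by rewrite distrC.
  + rewrite -(ler_pM2r W0) thE.
    have h1 : l2 * (3 * l1 + l2) * (T * e) <= g * (l2 - l1) * (T * e).
      rewrite ler_wpM2r ?mulr_ge0//; apply: le_trans g_ge.
      by rewrite ler_wpM2l//; have := l1_le2; lra.
    have h2 : l2 * ((l1 + l2) * (e * e)) <= g * ((l1 + l2) * (e * e)).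
      by rewrite ler_wpM2r ?mulr_ge0 ?addr_ge0.
    rewrite /W; lra.
- apply/thickeningP; exists p' => //.
  apply: le_trans (cvx _ _ _ (l1 * T) (l1 * e + l2 * (e + T)) _ _) _.
  + by rewrite distrC.
  + rewrite (le_trans (ler_distD p _ _))// lerD// ?(le_trans pp')//.
    by rewrite distrC.
  + by rewrite -(ler_pM2r W0) thE /W; lra.
Qed.

Lemma F2_lipschitz (g : R) (x y : M) :
  l2 * ((3 * l2 + l1) / (l2 - l1)) <= g ->
  F2 x `<=` thickening (F2 y) (g * d x y)%:E.
Proof.
move=> gE p F2p; pose Q := thickening [set p] (g * d x y)%:E.
have QP q i : `|q - p| <= g * d x y -> strip i Q q.
  by move=> pq; apply: sub_strip; apply/thickeningP; exists p.
have [| | | | |q F2q Qq] := F2_meet y Q.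
- apply/convex_thickening/convex_setP => _ _ t -> -> _.
  by rewrite -scalerDl subrKC scale1r.
- by move=> i; apply/closed_strip/compact_thickening/compact_set1.
- move=> u u' i.
  have /thickeningP[a /F1P F1a pa] := (refinement_finP _ _ _ _ _).1 F2p y.
  exists a; split; first by split.
  apply: QP; rewrite distrC (le_trans pa)// ler_wpM2r//; exact: l2_le_g.
- move=> u i i'; have [q [Kq pq _]] := K_meet_near g u x y y p gE F2p.
  by exists q; split; first split; [| exact: QP | exact: QP].
- move=> u z i i'; have [q [Kq pq Vq]] := K_meet_near g u x y z p gE F2p.
  by exists q; split; first split; [| exact: QP | exact: sub_strip].
apply/thickeningP; exists q => //; apply/norm_le_coord => i; rewrite !mxE.
by have [_ -> ] := (strip_thickening _ _ _ _).1 (Qq i); rewrite distrC.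
Qed.

End Finite.

(** * Extension of selections and infinite distances *)

(** The extension is the largest one, the infimum of the cones f a + d(a, .). *)
Lemma mcshane_extension {R : realType} {T : Type} (d : T -> T -> R)
    (A : set T) (f : T -> R) :
  (forall x, d x x = 0) -> (forall x y, d x y = d y x) ->
  (forall x y z, d x y <= d x z + d z y) -> A !=set0 ->
  (forall x y, A x -> A y -> `|f x - f y| <= d x y) ->
  exists2 g, (forall x, A x -> g x = f x) & forall x y, `|g x - g y| <= d x y.
Proof.
move=> dxx d_sym d_tri [a0 Aa0] f1.
pose S x := [set f a + d a x | a in A].
have S0 x : S x !=set0 by exists (f a0 + d a0 x); exists a0.
have lbS x : has_lbound (S x).
  exists (f a0 - d a0 x) => _ [a Aa <-].
  have := f1 a0 a Aa0 Aa; have := d_tri a0 a x; rewrite (d_sym x a).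
  by rewrite ler_norml => ? /andP[_ ?]; lra.
have leS x a : A a -> inf (S x) <= f a + d a x.
  by move=> Aa; apply: ge_inf => //; exists a.
have inf_lip x y : inf (S x) - d x y <= inf (S y).
  apply: lb_le_inf => // _ [a Aa <-].
  by have := leS x a Aa; have := d_tri a x y; rewrite (d_sym y x); lra.
exists (fun x => inf (S x)) => [x Ax|x y].
  apply/eqP; rewrite eq_le; apply/andP; split.
    by have := leS x x Ax; rewrite dxx addr0.
  apply: lb_le_inf => // _ [a Aa <-].
  by have := f1 x a Ax Aa; rewrite d_sym ler_norml => /andP[_]; lra.
have := inf_lip x y; have := inf_lip y x; rewrite (d_sym y x) ler_norml.
by move=> ? ?; apply/andP; split; lra.
Qed.

Lemma lip_seminorm_le1 {R : realType} {M : Type} (rho : M -> M -> \bar R)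
    {X : normedModType R} (M' : set M) (f : M -> X) (x y : M) (r : R) :
  (lip_seminorm rho M' f <= 1)%E -> M' x -> M' y -> 0 <= r ->
  rho x y = r%:E -> `|f x - f y| <= r.
Proof.
move=> f1 Mx My r0 xyr; rewrite leNgt; apply/negP => r_lt.
pose e := (`|f x - f y| - r) / (r + 1).
have e0 : 0 < e by rewrite divr_gt0 ?subr_gt0// ltr_wpDl.
have : (lip_seminorm rho M' f < (1 + e)%:E)%E.
  by apply: le_lt_trans f1 _; rewrite lte_fin ltrDl.
move=> /ereal_inf_lt[_ [l [l0 fl] <-]]; rewrite lte_fin => le.
have := fl x y Mx My; rewrite xyr -EFinM lee_fin => fxy.
have := ler_wpM2r r0 (ltW le).
have : e * (r + 1) = `|f x - f y| - r by rewrite divfK// lt0r_neq0// ltr_wpDl.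
by lra.
Qed.

(** The norm being a maximum, the two coordinates can be extended separately. *)
Lemma four_selection_extends {R : realType} {M N : Type}
    (rho : M -> M -> \bar R) (F : M -> set 'rV[R]_2) (d : N -> N -> R)
    (h : N -> M) :
  (forall M' : set M, M' #<= `I_4 ->
     exists f : M -> 'rV[R]_2,
       selection F M' f /\ (lip_seminorm rho M' f <= 1)%E) ->
  (forall x y, rho (h x) (h y) = (d x y)%:E) ->
  (forall x y, 0 <= d x y) -> (forall x, d x x = 0) ->
  (forall x y, d x y = d y x) -> (forall x y z, d x y <= d x z + d z y) ->
  forall x1 x2 x3 x4, exists g : N -> 'rV[R]_2,
    [/\ forall x y, `|g x - g y| <= d x y,
        F (h x1) (g x1), F (h x2) (g x2), F (h x3) (g x3) & F (h x4) (g x4)].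
Proof.
move=> sel rhoE d0 dxx d_sym d_tri x1 x2 x3 x4.
pose p n := nth x1 [:: x1; x2; x3; x4] n.
pose A : set N := p @` `I_4.
have [f [Ff f1]] := sel ((h \o p) @` `I_4) (card_image_le _ _).
have AM x : A x -> ((h \o p) @` `I_4) (h x) by move=> [n n4 <-]; exists n.
have fA x y : A x -> A y -> `|f (h x) - f (h y)| <= d x y.
  by move=> /AM Ax /AM Ay; apply: lip_seminorm_le1 f1 Ax Ay _ _.
have Ap n : (n < 4)%N -> A (p n) by exists n.
have H i : exists g : N -> R, (forall x, A x -> g x = f (h x) ord0 i) /\
    (forall x y, `|g x - g y| <= d x y).
  have [|||||g gf g1] := mcshane_extension d A (fun x => f (h x) ord0 i) => //.
  - by exists (p 0%N); exact: Ap.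
  - move=> x y Ax Ay; have /norm_le_coord/(_ i) := fA x y Ax Ay.
    by rewrite !mxE.
  - by exists g.
have [g gP] := choice H.
pose G x : 'rV[R]_2 := \row_i g i x.
have GA x : A x -> F (h x) (G x).
  move=> Ax; rewrite (_ : G x = f (h x)); first exact: Ff (AM _ Ax).
  by apply/rowP => i; rewrite mxE (gP i).1.
exists G; split.
- by move=> x y; apply/norm_le_coord => i; rewrite !mxE; exact: (gP i).2.
- exact: GA (Ap 0%N isT).
- exact: GA (Ap 1%N isT).
- exact: GA (Ap 2%N isT).
- exact: GA (Ap 3%N isT).
Qed.

Lemma thickening_pinfty {R : realType} {X : normedModType R} (A : set X)
    (p : X) : A !=set0 -> thickening A +oo%E p.
Proof.
move=> [a Aa]; exists a => //; exists (p - a); last by rewrite addrC subrK.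
by rewrite /cball0/= leey.
Qed.

Section Component.
Context {R : realType} {M : Type} (rho : M -> M -> \bar R) (x0 : M).
Hypothesis rho_pm : pseudometric rho.

Definition component := {z : M | rho x0 z \is a fin_num}.

Definition component_dist (a b : component) : R := fine (rho (sval a) (sval b)).

Lemma component_distE (a b : component) :
  rho (sval a) (sval b) = (component_dist a b)%:E.
Proof.
have [rho0 _ rho_sym rho_tri] := rho_pm.
rewrite /component_dist fineK// ge0_fin_numE//.
rewrite (le_lt_trans (rho_tri _ _ x0))// (rho_sym _ x0) lte_add_pinfty//.
  by rewrite -ge0_fin_numE//; exact: (svalP a).
by rewrite -ge0_fin_numE//; exact: (svalP b).
Qed.

Lemma component_dist_pseudometric :
  [/\ forall a b, 0 <= component_dist a b, forall a, component_dist a a = 0,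
      forall a b, component_dist a b = component_dist b a &
      forall a b c,
        component_dist a b <= component_dist a c + component_dist c b].
Proof.
have [rho0 rho_xx rho_sym rho_tri] := rho_pm; split.
- by move=> a b; rewrite -lee_fin -component_distE.
- by move=> a; rewrite /component_dist rho_xx.
- by move=> a b; rewrite /component_dist rho_sym.
- by move=> a b c; rewrite -lee_fin EFinD -!component_distE.
Qed.

(** A point z at infinite distance from a contributes the whole space to the
    intersection, since G z is non-empty. *)
Lemma refinement_component {X : normedModType R} (l : R) (G : M -> set X)
    (a : component) : 0 < l -> (forall z, G z !=set0) ->
  refinement rho l G (sval a) =
  refinement (fun b c => (component_dist b c)%:E) l (G \o sval) a.
Proof.
move=> l0 G0; have [rho0 _ rho_sym rho_tri] := rho_pm.
apply/seteqP; split=> p H z _.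
  by have := H (sval z) I; rewrite component_distE.
have [zN|zN] := boolP (rho x0 z \is a fin_num).
  by have := H (exist _ z zN) I; rewrite -component_distE.
suff -> : rho (sval a) z = +oo%E.
  by rewrite gt0_muley ?lte_fin//; exact: thickening_pinfty.
apply/eqP; rewrite -leye_eq leNgt; apply: contra zN => az.
rewrite ge0_fin_numE// (le_lt_trans (rho_tri _ _ (sval a)))//.
by rewrite lte_add_pinfty// -ge0_fin_numE//; exact: (svalP a).
Qed.

End Component.

Lemma refinements_lipschitz (R : realType) (M : Type) (rho : M -> M -> \bar R)
    (F : M -> set 'rV[R]_2) :
  pseudometric rho ->
  (forall x, convex_compacts (F x)) ->
  (forall M' : set M, M' #<= `I_4 ->
     exists f : M -> 'rV[R]_2,
       selection F M' f /\ (lip_seminorm rho M' f <= 1)%E) ->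
  forall l1 l2 g : R,
     1 <= l1 -> 3 * l1 <= l2 -> l2 * ((3 * l2 + l1) / (l2 - l1)) <= g ->
     let F1 := refinement rho l1 F in
     let F2 := refinement rho l2 F1 in
     (forall x, F2 x !=set0) /\
     (forall x y, (hausdorff_dist (F2 x) (F2 y) <= g%:E * rho x y)%E).
Proof.
move=> rho_pm F_cc sel l1 l2 g l1_ge1 l2_ge gE F1 F2.
have [rho0 rho_xx rho_sym rho_tri] := rho_pm.
have l1_gt0 : 0 < l1 by exact: lt_le_trans l1_ge1.
have l2_gt0 : 0 < l2 by apply: lt_le_trans l2_ge; rewrite mulr_gt0.
have l2g := l2_le_g l1 l2 l1_ge1 l2_ge g gE.
have g0 : 0 < g by exact: lt_le_trans l2g.
pose d x := component_dist rho x.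
pose E x (z : component rho x) : set 'rV[R]_2 := F (sval z).
pose E1 x := refinement (fun b c => (d x b c)%:E) l1 (E x).
pose E2 x := refinement (fun b c => (d x b c)%:E) l2 (E1 x).
have sub x : rho x x \is a fin_num by rewrite rho_xx.
have dP x := component_dist_pseudometric rho x rho_pm.
have selE x : forall x1 x2 x3 x4, exists g : component rho x -> 'rV[R]_2,
    [/\ forall x' y', `|g x' - g y'| <= d x x' y',
      E x x1 (g x1), E x x2 (g x2), E x x3 (g x3) & E x x4 (g x4)].
  have [? ? ? ?] := dP x.
  apply: (four_selection_extends rho F (d x) sval) => //.
  exact: component_distE.
have F0 z : F z !=set0 by have [] := F_cc z.
have F1E x a : F1 (sval a) = E1 x a.
  exact: refinement_component.
have F1_n0 x : F1 x !=set0.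
  have [? ? ? ?] := dP x; rewrite (F1E x (exist _ x (sub x))).
  by apply: (F1_neq0 (d x)) => // z; exact: F_cc.
have F2E x a : F2 (sval a) = E2 x a.
  rewrite /F2 refinement_component//; congr (refinement _ _ _ _).
  by apply/funext => z /=; exact: F1E.
split=> [x|x y].
  have [? ? ? ?] := dP x; rewrite (F2E x (exist _ x (sub x))).
  by apply: (F2_neq0 (d x)) => // z; exact: F_cc.
have [xy|xy] := boolP (rho x y \is a fin_num); last first.
  suff -> : rho x y = +oo%E by rewrite gt0_muley ?lte_fin// leey.
  by apply/eqP; rewrite -leye_eq leNgt -ge0_fin_numE.
pose a : component rho x := exist _ x (sub x).
pose b : component rho x := exist _ y xy.
have [d0 dxx d_sym d_tri] := dP x.
have lip b1 b2 : E2 x b1 `<=` thickening (E2 x b2) (g * d x b1 b2)%:E.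
  by apply: F2_lipschitz => // z; exact: F_cc.
have ba : d x b a = d x a b := d_sym b a.
have ab : rho x y = (d x a b)%:E := component_distE rho x rho_pm a b.
rewrite ab -EFinM; apply/lee_addgt0Pr => e e0.
apply: ereal_inf_lbound; exists (g * d x a b + e) => //; split.
- by rewrite ltr_wpDl// mulr_ge0// ltW.
- rewrite (F2E x a) (F2E x b) => p /(lip b a); apply: thickening_le.
  by rewrite ba lerDl ltW.
- rewrite (F2E x a) (F2E x b) => p /(lip a b); apply: thickening_le.
  by rewrite lerDl ltW.
Qed.

Theorem theorem5p5 (R : realType) (M : Type) (rho : M -> M -> \bar R)
    (F : M -> set 'rV[R]_2) :
  pseudometric rho ->
  (forall x, convex_compacts (F x)) ->
  (forall M' : set M, M' #<= `I_4 ->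
     exists f : M -> 'rV[R]_2,
       selection F M' f /\ (lip_seminorm rho M' f <= 1)%E) ->
  (forall l1 l2 g : R,
     1 <= l1 -> 3 * l1 <= l2 -> l2 * ((3 * l2 + l1) / (l2 - l1)) <= g ->
     let F1 := refinement rho l1 F in
     let F2 := refinement rho l2 F1 in
     (forall x, F2 x !=set0) /\
     (forall x y, (hausdorff_dist (F2 x) (F2 y) <= g%:E * rho x y)%E)) /\
  (let F1 := refinement rho 1 F in
   let F2 := refinement rho 3 F1 in
   (forall x, F2 x !=set0) /\
   (forall x y, (hausdorff_dist (F2 x) (F2 y) <= 15%:E * rho x y)%E)).
Proof.
move=> rho_pm F_cc sel; split; first exact: refinements_lipschitz.
have le1 : (1 : R) <= 1 by [].
apply: (refinements_lipschitz R M rho F rho_pm F_cc sel 1 3 15 le1); first lra.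
by rewrite mulrA ler_pdivrMr; lra.
Qed.
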